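(* Let $(G,\mu,\sigma)$ be a finite weighted graph with vertex measure $\mu$ and signature $\sigma:E^{or}\to H$, where $H=O(d)$ or $U(d)$, and let $K\in\mathbb{R}$. The following are equivalent (inequalities between functions on $V$ are pointwise): (i) $CD^\sigma(K,\infty)$ holds, i.e., for any $f:V\to\mathbb{K}^d$, $\Gamma_2^\sigma(f)\ge K\,\Gamma^\sigma(f)$; (ii) for any $f:V\to\mathbb{K}^d$ and $t\ge0$, $\Gamma^\sigma(P_t^\sigma f)\le e^{-2Kt}P_t(\Gamma^\sigma(f))$; (iii) for any $f:V\to\mathbb{K}^d$ and $t\ge0$, $P_t(|f|^2)-|P_t^\sigma f|^2\ge\frac1K(e^{2Kt}-1)\,\Gamma^\sigma(P_t^\sigma f)$, where $(e^{2Kt}-1)/K$ is replaced by $2t$ in the case $K=0$.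
   Context: $G=(V,E,w)$ is a finite undirected simple graph with edge weights $w_{xy}=w_{yx}>0$ for $\{x,y\}\in E$; $x\sim y$ means $\{x,y\}\in E$; $\mu:V\to(0,\infty)$; $E^{or}=\{(x,y),(y,x)\mid\{x,y\}\in E\}$. $\mathbb{K}=\mathbb{R}$ if $H=O(d)$, $\mathbb{K}=\mathbb{C}$ if $H=U(d)$. A signature is a map $\sigma:E^{or}\to H$ with $\sigma_{yx}=\sigma_{xy}^{-1}$. For $u:V\to\mathbb{K}$, $\Delta u(x)=\frac1{\mu(x)}\sum_{y\sim x}w_{xy}(u(y)-u(x))$; for $f:V\to\mathbb{K}^d$, $\Delta^\sigma f(x)=\frac1{\mu(x)}\sum_{y\sim x}w_{xy}(\sigma_{xy}f(y)-f(x))$. Heat semigroups: $P_t=e^{t\Delta}$ and $P_t^\sigma=e^{t\Delta^\sigma}$. Define $2\Gamma^\sigma(f,g)=\Delta(f^T\overline g)-f^T(\overline{\Delta^\sigma g})-(\Delta^\sigma f)^T\overline g$, $2\Gamma_2^\sigma(f,g)=\Delta\Gamma^\sigma(f,g)-\Gamma^\sigma(f,\Delta^\sigma g)-\Gamma^\sigma(\Delta^\sigma f,g)$, $\Gamma^\sigma(f)=\Gamma^\sigma(f,f)$, $\Gamma_2^\sigma(f)=\Gamma_2^\sigma(f,f)$. $|f|^2$ denotes the function $x\mapsto f(x)^T\overline{f(x)}$. *)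

(* Defs.v *)
From HB Require Import structures.
From mathcomp Require Import all_boot all_order all_algebra.
From mathcomp Require Import spectral complex.
From mathcomp Require Import all_classical all_reals all_analysis.

Set Implicit Arguments.
Unset Strict Implicit.
Unset Printing Implicit Defensive.

Import Order.TTheory GRing.Theory Num.Theory.
Import numFieldNormedType.Exports.

Local Open Scope ring_scope.

(* A weighted graph with a vertex measure. The functions [weight] (here) and
   [sig] (below) are total for convenience; their values at pairs of
   non-adjacent vertices are unconstrained and never used. *)
Record wgraph (R : realType) := WGraph {
  vertex :> finType;
  adj : rel vertex;
  weight : vertex -> vertex -> R;
  vmeas : vertex -> R;
  adj_irr : irreflexive adj;
  adj_sym : symmetric adj;
  weight_sym : forall x y, adj x y -> weight x y = weight y x;
  weight_gt0 : forall x y, adj x y -> 0 < weight x y;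
  vmeas_gt0 : forall x, 0 < vmeas x
}.

(* The family H = O(d) or H = U(d), which determines the scalar field. *)
Variant group_kind := Orthogonal | Unitary.

Section Scalars.
Variable R : realType.

Definition scalarK (H : group_kind) : numFieldType :=
  match H with
  | Orthogonal => R : numFieldType
  | Unitary => R[i] : numFieldType
  end.

Definition embed (H : group_kind) : R -> scalarK H :=
  match H return R -> scalarK H with
  | Orthogonal => fun a => a
  | Unitary => fun a => (a%:C)%C
  end.

Definition sconj (H : group_kind) : scalarK H -> scalarK H :=
  match H return scalarK H -> scalarK H with
  | Orthogonal => fun z => z
  | Unitary => fun z : R[i] => (z^*)%C
  end.

Definition in_group (H : group_kind) (d : nat) : 'M[scalarK H]_d -> Prop :=
  match H return 'M[scalarK H]_d -> Prop with
  | Orthogonal => fun A => A *m A^T = 1%:M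
  | Unitary => fun A : 'M[R[i]]_d => A \is unitarymx
  end.

End Scalars.

Record signature (R : realType) (G : wgraph R) (H : group_kind) (d : nat) :=
  Signature {
    sig :> G -> G -> 'M[scalarK R H]_d;
    sig_group : forall x y, adj x y -> in_group (sig x y);
    sig_inv : forall x y, adj x y -> sig y x = invmx (sig x y)
  }.

(* The exponential e^{tL} of an operator L on functions X -> W, evaluated
   pointwise as the sum of its power series. When X is finite and W is
   finite-dimensional, pointwise convergence is convergence in the
   finite-dimensional space of functions X -> W. *)
Definition exp_op (K : numFieldType) (X : Type) (W : normedModType K)
    (L : (X -> W) -> (X -> W)) (t : K) (f : X -> W) (x : X) : W :=
  limn (series (fun k : nat => (t ^+ k / k`!%:R) *: iter k L f x)).

Section Operators.
Variables (R : realType) (G : wgraph R) (H : group_kind) (d : nat).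
Variable sigma : signature G H d.
Local Notation K := (scalarK R H).
Implicit Types (u : G -> K) (f g : G -> 'cV[K]_d) (x : G) (t : R).

Definition laplacian u x : K :=
  (embed H (vmeas x))^-1 *
    \sum_(y | adj x y) embed H (weight x y) * (u y - u x).

Definition conn_laplacian f x : 'cV[K]_d :=
  (embed H (vmeas x))^-1 *:
    \sum_(y | adj x y) embed H (weight x y) *: (sigma x y *m f y - f x).

Definition heat t u : G -> K :=
  @exp_op K G K^o laplacian (embed H t) u.

Definition conn_heat t f : G -> 'cV[K]_d :=
  exp_op conn_laplacian (embed H t) f.

Definition hprod f g x : K := ((f x)^T *m map_mx (@sconj R H) (g x)) 0 0.

Definition sqnorm f : G -> K := hprod f f.

Definition Gamma f g x : K :=
  2^-1 * (laplacian (hprod f g) x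
          - hprod f (conn_laplacian g) x
          - hprod (conn_laplacian f) g x).

Definition Gamma2 f g x : K :=
  2^-1 * (laplacian (Gamma f g) x
          - Gamma f (conn_laplacian g) x
          - Gamma (conn_laplacian f) g x).

(* Both sides below are real. For R[i], the order a <= b means that b - a is
   real and nonnegative, so this is the usual inequality of real numbers. *)
Definition CD_infty (kappa : R) : Prop :=
  forall f x, embed H kappa * Gamma f f x <= Gamma2 f f x.

End Operators.

Definition exp_coef (R : realType) (kappa t : R) : R :=
  if kappa == 0 then 2 * t else (expR (2 * kappa * t) - 1) / kappa.

(* Main.v *)
Require Import Defs.
From mathcomp Require Import all_boot all_order all_algebra.
From mathcomp Require Import complex ring lra.
From mathcomp Require Import all_classical all_reals all_analysis.

Set Implicit Arguments.
Unset Strict Implicit.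
Unset Printing Implicit Defensive.

Import Order.TTheory GRing.Theory Num.Theory.
Import numFieldNormedType.Exports.
Local Open Scope ring_scope.

(** The three conditions are linked by differentiating along the interpolation
    s |-> P_s (Q (P^sigma_(t-s) f)), where Q is a quadratic form in f.

    - Write V_s for P^sigma_(t-s) f.  The derivative of P_s (|V_s|^2) is
      2 P_s (Gamma^sigma V_s), and that of P_s (Gamma^sigma V_s) is
      2 P_s (Gamma_2^sigma V_s): the definitions of Gamma^sigma and
      Gamma_2^sigma are made for this, P_s contributing the term with Delta and
      V_s the two terms with Delta^sigma.
    - [gradient_estimate]: under the curvature-dimension condition
      e^(-2 kappa s) P_s (Gamma^sigma V_s) has a nonnegative derivative, because
      the heat semigroup preserves nonnegativity ([heat_ge0]); compare the
      values at s = 0 and s = t.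
    - [variance_estimate]: the gradient estimate at time s, applied to V_s, says
      2 P_s (Gamma^sigma V_s) >= 2 e^(2 kappa s) Gamma^sigma (P^sigma_t f); this
      uses the semigroup law for P^sigma.  Integrate over [0, t], that is,
      compare with the primitive [exp_coef] of 2 e^(2 kappa s).
    - [curvature_dimension]: the difference F(t) of the two sides of the
      variance estimate is nonnegative for t >= 0, and F(0) = F'(0) = 0; hence
      F''(0) >= 0, and F''(0) = 4 (Gamma_2^sigma f - kappa Gamma^sigma f).

    Nothing here distinguishes the real from the complex case once derivatives
    in the real variable t are available for scalar-valued functions.  These are
    taken coordinatewise, through the real and imaginary parts.  On functions on
    a finite set, both Laplacians are given by matrices ([mxop]), so one theory
    of matrix exponentials ([kexp]) covers both semigroups.  Uniqueness for the
    linear differential equation V' = A V ([kexp_ode_unique]) yields the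
    semigroup law and, by comparing e^(t Delta) with e^(-ct) e^(t (Delta + c)),
    the positivity of the heat semigroup. *)

(** * Real coordinates of the scalar field *)

Section Coordinates.
Local Open Scope classical_set_scope.
Variables (R : realType) (H : group_kind).
Local Notation K := (scalarK R H).

(** The scalars over both fields are handled through a common interface: the
    real part [kre] and the imaginary part [kim], the latter being zero over the
    reals. *)
Definition kre : K -> R :=
  match H return scalarK R H -> R with
  | Orthogonal => fun z => z
  | Unitary => fun z : R[i] => complex.Re z
  end.

Definition kim : K -> R :=
  match H return scalarK R H -> R with
  | Orthogonal => fun=> 0
  | Unitary => fun z : R[i] => complex.Im z
  end.

Definition kmk (a b : R) : K :=
  match H return scalarK R H with
  | Orthogonal => a
  | Unitary => (a +i* b)%C
  end.

Lemma kreD z w : kre (z + w) = kre z + kre w.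
Proof. by rewrite /kre; case: H z w => // -[a b] [c d]. Qed.
Lemma kimD z w : kim (z + w) = kim z + kim w.
Proof. by rewrite /kim; case: H z w => [z w|[a b] [c d]]; rewrite ?addr0. Qed.
Lemma kreM z w : kre (z * w) = kre z * kre w - kim z * kim w.
Proof.
by rewrite /kre /kim; case: H z w => [z w|[a b] [c d]]; rewrite ?mulr0 ?subr0.
Qed.
Lemma kimM z w : kim (z * w) = kre z * kim w + kim z * kre w.
Proof.
rewrite /kre /kim; case: H z w => [z w|[a b] [c d]] //.
by rewrite mulr0 mul0r addr0.
Qed.
Lemma kre0 : kre 0 = 0. Proof. by rewrite /kre; case: H. Qed.
Lemma kim0 : kim 0 = 0. Proof. by rewrite /kim; case: H. Qed.
Lemma kreN z : kre (- z) = - kre z.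
Proof. by rewrite /kre; case: H z => // -[]. Qed.
Lemma kimN z : kim (- z) = - kim z.
Proof. by rewrite /kim; case: H z => [z|[]//]; rewrite oppr0. Qed.
Lemma kre_conj z : kre (sconj z) = kre z.
Proof. by rewrite /kre; case: H z => // -[]. Qed.
Lemma kim_conj z : kim (sconj z) = - kim z.
Proof. by rewrite /kim; case: H z => [z|[]//]; rewrite oppr0. Qed.
Lemma kre_embed (a : R) : kre (embed H a) = a.
Proof. by rewrite /kre; case: H. Qed.
Lemma kim_embed (a : R) : kim (embed H a) = 0.
Proof. by rewrite /kim; case: H. Qed.

Lemma k_inj z w : kre z = kre w -> kim z = kim w -> z = w.
Proof. by rewrite /kre /kim; case: H z w => // -[a b] [c d] /= -> ->. Qed.

Lemma lekE (z w : K) : (z <= w) = (kim w == kim z) && (kre z <= kre w).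
Proof. by rewrite /kre /kim; case: H z w => [z w|z w]; rewrite ?eqxx ?lecE. Qed.

Lemma kre_kmk a b : kre (kmk a b) = a.
Proof. by rewrite /kre /kmk; case: H. Qed.
Lemma kim_orth z : H = Orthogonal -> kim z = 0.
Proof. by rewrite /kim; case: H z. Qed.
Lemma kim_kmk a b : (H = Orthogonal -> b = 0) -> kim (kmk a b) = b.
Proof. by rewrite /kim /kmk; case: H => // ->. Qed.

Lemma norm_le_coord (z : K) : `|z| <= embed H (`|kre z| + `|kim z|).
Proof.
rewrite /kre /kim; case: H z => [z|z] /=; first by rewrite normr0 addr0.
rewrite [X in `|X|]complexE (le_trans (ler_normD _ _))// normrM.
have -> : `|'i%C : R[i]| = 1.
  by rewrite normc_def /= expr0n add0r expr1n sqrtr1.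
by rewrite mul1r !normc_def /= expr0n !addr0 !sqrtr_sqr -rmorphD.
Qed.

(** Over the reals [kmk] drops its second argument, whence the side
    condition. *)
Lemma cvg_kmk (u : nat -> K) a b : (H = Orthogonal -> b = 0) ->
  kre (u n) @[n --> \oo] --> a -> kim (u n) @[n --> \oo] --> b ->
  u @ \oo --> kmk a b.
Proof.
move=> Hb ua ub; apply/cvgrPdist_lt => e e0.
have [eE re0] : e = embed H (kre e) /\ 0 < kre e.
  move: e0; rewrite lt_def lekE kre0 kim0 => /and3P[e0 /eqP ie re0].
  have eE : e = embed H (kre e) by apply: k_inj; rewrite ?kre_embed ?kim_embed.
  split=> //; rewrite lt_def re0 andbT; apply: contra e0 => /eqP r0.
  by apply/eqP/k_inj; rewrite ?r0 ?kre0 ?kim0.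
have h : 0 < kre e / 2 by rewrite divr_gt0.
move/cvgrPdist_lt : ua => /(_ _ h) ua; move/cvgrPdist_lt : ub => /(_ _ h) ub.
near=> n; apply: (le_lt_trans (norm_le_coord _)).
rewrite eE lt_def lekE !kre_embed !kim_embed eqxx /= kreD kimD kreN kimN.
rewrite kre_kmk kim_kmk//.
have lt : `|a - kre (u n)| + `|b - kim (u n)| < kre e.
  rewrite (splitr (kre e)) ltrD//; [near: n; exact: ua|near: n; exact: ub].
rewrite (ltW lt) andbT; apply/eqP => /(congr1 kre); rewrite !kre_embed => ee.
by rewrite ee ltxx in lt.
Unshelve. all: by end_near. Qed.

Lemma kre_sum (I : Type) (r : seq I) (P : pred I) (F : I -> K) :
  kre (\sum_(i <- r | P i) F i) = \sum_(i <- r | P i) kre (F i).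
Proof. exact: (big_morph _ kreD kre0). Qed.
Lemma kim_sum (I : Type) (r : seq I) (P : pred I) (F : I -> K) :
  kim (\sum_(i <- r | P i) F i) = \sum_(i <- r | P i) kim (F i).
Proof. exact: (big_morph _ kimD kim0). Qed.

Lemma embed0 : embed H 0 = 0 :> K.
Proof. by apply: k_inj; rewrite ?kre_embed ?kim_embed ?kre0 ?kim0. Qed.
Lemma embed1 : embed H 1 = 1 :> K. Proof. by case: H. Qed.
Lemma embedN (a : R) : embed H (- a) = - embed H a.
Proof. by apply: k_inj; rewrite ?kreN ?kimN ?kre_embed ?kim_embed ?oppr0. Qed.
Lemma embedD (a b : R) : embed H (a + b) = embed H a + embed H b.
Proof. by apply: k_inj; rewrite ?kreD ?kimD ?kre_embed ?kim_embed ?addr0. Qed.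
Lemma embedM (a b : R) : embed H (a * b) = embed H a * embed H b.
Proof.
apply: k_inj; rewrite ?kreM ?kimM ?kre_embed ?kim_embed ?mulr0 ?mul0r;
by rewrite ?subr0 ?addr0.
Qed.
Lemma embed_nat n : embed H n%:R = n%:R :> K.
Proof. by elim: n => [|n IH]; rewrite ?embed0// !mulrS embedD IH embed1. Qed.
Lemma embedV (a : R) : embed H a^-1 = (embed H a)^-1.
Proof.
have [->|a0] := eqVneq a 0; first by rewrite invr0 embed0 invr0.
have e0 : embed H a != 0.
  by apply: contra a0 => /eqP/(congr1 kre); rewrite kre_embed kre0 => ->.
by apply: (mulfI e0); rewrite -embedM !mulfV ?embed1.
Qed.
Lemma embedX (a : R) n : embed H (a ^+ n) = embed H a ^+ n.
Proof. by elim: n => [|n IH]; rewrite ?embed1// !exprS embedM IH. Qed.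
Lemma embed_ge0 (a : R) : 0 <= a -> 0 <= embed H a :> K.
Proof. by move=> a0; rewrite lekE kre_embed kim_embed kre0 kim0 eqxx. Qed.
Lemma kre_embedM a z : kre (embed H a * z) = a * kre z.
Proof. by rewrite kreM kre_embed kim_embed mul0r subr0. Qed.
Lemma kim_embedM a z : kim (embed H a * z) = a * kim z.
Proof. by rewrite kimM kre_embed kim_embed mul0r addr0. Qed.

End Coordinates.

(** * Derivatives of scalar-valued functions of a real variable *)

Section Derivatives.
Local Open Scope classical_set_scope.
Variables (R : realType) (H : group_kind).
Local Notation K := (scalarK R H).
Implicit Types z w : K.

(** Differentiability is expressed on the coordinates, so that the mean value
    theorem and termwise differentiation of real power series apply. *)
Definition kderiv (F : R -> K) (s : R) (D : K) :=
  is_derive s 1 (fun t => kre (F t)) (kre D) /\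
  is_derive s 1 (fun t => kim (F t)) (kim D).

Lemma kderiv_eq F s D D' : D = D' -> kderiv F s D -> kderiv F s D'.
Proof. by move=> ->. Qed.

Lemma kderiv_ext F G s D : (forall t, F t = G t) ->
  kderiv F s D -> kderiv G s D.
Proof. by move=> /funext ->. Qed.

Lemma kderiv_embed (c : R -> R) (s D : R) : is_derive s 1 c D ->
  kderiv (fun t => embed H (c t)) s (embed H D).
Proof.
move=> dc; split; rewrite ?kre_embed ?kim_embed.
  by under eq_fun do rewrite kre_embed.
by under eq_fun do rewrite kim_embed; exact: is_derive_cst.
Qed.

Lemma kderiv_cst z s : kderiv (fun=> z) s 0.
Proof. by split; rewrite ?kre0 ?kim0; exact: is_derive_cst. Qed.

Lemma kderivD F G s D E : kderiv F s D -> kderiv G s E ->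
  kderiv (fun t => F t + G t) s (D + E).
Proof.
move=> [F1 F2] [G1 G2]; split; rewrite ?kreD ?kimD.
  by under eq_fun do rewrite kreD; exact: (is_deriveD F1 G1).
by under eq_fun do rewrite kimD; exact: (is_deriveD F2 G2).
Qed.

Lemma kderivN F s D : kderiv F s D -> kderiv (fun t => - F t) s (- D).
Proof.
move=> [F1 F2]; split; rewrite ?kreN ?kimN.
  by under eq_fun do rewrite kreN; exact: (is_deriveN F1).
by under eq_fun do rewrite kimN; exact: (is_deriveN F2).
Qed.

Lemma kderivB F G s D E : kderiv F s D -> kderiv G s E ->
  kderiv (fun t => F t - G t) s (D - E).
Proof. by move=> dF dG; exact/kderivD/kderivN. Qed.

Lemma kderivM F G s D E : kderiv F s D -> kderiv G s E ->
  kderiv (fun t => F t * G t) s (D * G s + F s * E).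
Proof.
move=> [F1 F2] [G1 G2]; split.
  under eq_fun do rewrite kreM.
  apply: is_derive_eq (is_deriveB (is_deriveM F1 G1) (is_deriveM F2 G2)) _.
  by rewrite kreD !kreM /GRing.scale /=; ring.
under eq_fun do rewrite kimM.
apply: is_derive_eq (is_deriveD (is_deriveM F1 G2) (is_deriveM F2 G1)) _.
by rewrite kimD !kimM /GRing.scale /=; ring.
Qed.

Lemma kderivMl z F s D : kderiv F s D -> kderiv (fun t => z * F t) s (z * D).
Proof.
move=> dF; apply: kderiv_eq (kderivM (kderiv_cst z s) dF).
by rewrite mul0r add0r.
Qed.

Lemma kderiv_sum (I : Type) (r : seq I) (P : pred I) (F : I -> R -> K) s
    (D : I -> K) : (forall i, kderiv (F i) s (D i)) ->
  kderiv (fun t => \sum_(i <- r | P i) F i t) s (\sum_(i <- r | P i) D i).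
Proof.
move=> dF; elim: r => [|i r IH].
  by rewrite big_nil; under eq_fun do rewrite big_nil; exact: kderiv_cst.
rewrite big_cons; under eq_fun do rewrite big_cons.
by case: (P i) => //; exact: kderivD.
Qed.

Lemma kderiv_conj F s D : kderiv F s D ->
  kderiv (fun t => sconj (F t)) s (sconj D).
Proof.
move=> [F1 F2]; split; rewrite ?kre_conj ?kim_conj.
  by under eq_fun do rewrite kre_conj.
by under eq_fun do rewrite kim_conj; exact: (is_deriveN F2).
Qed.

Lemma is_derive_subl (t s : R) : is_derive s 1 (fun r : R => t - r) (- 1).
Proof.
apply: is_derive_eq (is_deriveB (is_derive_cst t s 1) (is_derive_id s 1)) _.
by rewrite sub0r.
Qed.

Lemma kderiv_subl F t s D : kderiv F (t - s) D ->
  kderiv (fun r => F (t - r)) s (- D).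
Proof.
move=> [F1 F2]; split; rewrite ?kreN ?kimN -mulrN1.
  exact: (@is_derive1_comp R (fun r => kre (F r)) (fun r => t - r) s _ _ F1
    (is_derive_subl t s)).
exact: (@is_derive1_comp R (fun r => kim (F r)) (fun r => t - r) s _ _ F2
  (is_derive_subl t s)).
Qed.

Lemma is_derive_continuous (f df : R -> R) :
  (forall s : R, is_derive s 1 f (df s)) -> continuous f.
Proof.
move=> fdf s; have [fs _] := fdf s.
exact/differentiable_continuous/derivable1_diffP.
Qed.

(** Both coordinates are treated by the mean value theorem: a nonnegative
    derivative is real, so the imaginary part of [F] is constant. *)
Lemma kderiv_le F D (t : R) : 0 <= t -> (forall s, kderiv F s (D s)) ->
  (forall s, 0 <= s -> s <= t -> 0 <= D s) -> F 0 <= F t.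
Proof.
move=> t0 dF D0.
have cont (f df : R -> R) : (forall s : R, is_derive s 1 f (df s)) ->
    exists2 c, c \in `[0, t]%R & f t - f 0 = df c * (t - 0).
  move=> df0; apply: MVT_segment => //.
  exact/continuous_subspaceT/(is_derive_continuous df0).
have Dc c : c \in `[0, t]%R -> 0 <= kre (D c) /\ kim (D c) = 0.
  rewrite in_itv /= => /andP[c0 ct]; move: (D0 _ c0 ct).
  by rewrite lekE kre0 kim0 => /andP[/eqP].
rewrite lekE; apply/andP; split.
  have [c /Dc[_ Dc0]] := cont _ _ (fun s => (dF s).2).
  by rewrite Dc0 mul0r => /eqP; rewrite subr_eq0.
have [c /Dc[Dc0 _]] := cont _ _ (fun s => (dF s).1).
by rewrite -subr_ge0 => ->; rewrite subr0 mulr_ge0.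
Qed.

Lemma kderiv_const F (s t : R) : (forall s, kderiv F s 0) -> F s = F t.
Proof.
move=> dF; apply: k_inj.
  apply: (is_derive_0_is_cst (f := fun t => kre (F t))) => r.
  by rewrite -(kre0 R H); exact: (dF r).1.
apply: (is_derive_0_is_cst (f := fun t => kim (F t))) => r.
by rewrite -(kim0 R H); exact: (dF r).2.
Qed.

(** If [D < 0], then [f'] is negative on some interval ]0, e[ because
    [f' 0 = 0], and the mean value theorem makes [f (e / 2)] negative. *)
Lemma derive2_ge0 (f f' : R -> R) (D : R) :
  (forall s : R, is_derive s 1 f (f' s)) -> is_derive (0 : R) 1 f' D ->
  f 0 = 0 -> f' 0 = 0 -> (forall t, 0 <= t -> 0 <= f t) -> 0 <= D.
Proof.
move=> df [df' dD] f0 f'0 fge0; rewrite leNgt; apply/negP => D0.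
have : h^-1 *: (f' (h + 0) - f' 0) @[h --> 0^'] --> D.
  have := df'; rewrite /derivable => /cvg_ex[/= l hl].
  have -> : D = l.
    rewrite -dD /derive; apply/cvg_lim => //=.
  move: hl; under eq_fun do rewrite [_ *: 1]mulr1.
  by [].
move=> /cvgrPdist_lt /(_ (- D)); rewrite oppr_gt0 => /(_ D0).
rewrite /dnbhs /within /= => /nbhs_ballP [e /= e0 He].
have neg h : 0 < h -> h < e -> f' h < 0.
  move=> h0 he.
  have := He h; rewrite /ball /= sub0r normrN gtr0_norm// => /(_ he).
  rewrite gt_eqF// => /(_ isT); rewrite addr0 f'0 subr0 ltr_norml opprK.
  move=> /andP[h1 _]; rewrite -(@pmulr_rlt0 _ h^-1) ?invr_gt0//.
  by move: h1; rewrite /GRing.scale /=; lra.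
have e2 : 0 < e / 2 by rewrite divr_gt0.
have [|c] := @MVT _ f f' 0 (e / 2) e2 (fun x _ => df x).
  exact/continuous_subspaceT/(is_derive_continuous df).
rewrite in_itv /= => /andP[c0 ce]; rewrite f0 !subr0 => fe.
have := fge0 _ (ltW e2); rewrite fe leNgt => /negP; apply.
rewrite pmulr_llt0// neg// (lt_trans ce)// ltr_pdivrMr//.
by rewrite mulr_natr mulr2n ltrDl.
Qed.

(** The imaginary part of [F] vanishes on the half-line, so the second
    derivative test applies to it and to its opposite. *)
Lemma kderiv2_ge0 (F F' : R -> K) (D : K) : (forall s, kderiv F s (F' s)) ->
  kderiv F' 0 D -> F 0 = 0 -> F' 0 = 0 -> (forall t, 0 <= t -> 0 <= F t) ->
  0 <= D.
Proof.
move=> dF [dF1 dF2] F0 F'0 Fge0.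
have Fge t : 0 <= t -> 0 <= kre (F t) /\ kim (F t) = 0.
  by move=> /Fge0; rewrite lekE kre0 kim0 => /andP[/eqP].
have dFN (s : R) : is_derive s 1 (fun t => - kim (F t)) (- kim (F' s)).
  exact: (is_deriveN (dF s).2).
have dFN2 : is_derive (0 : R) 1 (fun t => - kim (F' t)) (- kim D).
  exact: (is_deriveN dF2).
have D1 : 0 <= - kim D.
  apply: (derive2_ge0 dFN dFN2); rewrite ?F0 ?F'0 ?kim0 ?oppr0//.
  by move=> t /Fge[_ ->]; rewrite oppr0.
have D2 : 0 <= kim D.
  apply: (derive2_ge0 (fun s => (dF s).2) dF2); rewrite ?F0 ?F'0 ?kim0//.
  by move=> t /Fge[_ ->].
have D3 : 0 <= kre D.
  apply: (derive2_ge0 (fun s => (dF s).1) dF1); rewrite ?F0 ?F'0 ?kre0//.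
  by move=> t /Fge[].
by rewrite lekE kre0 kim0 D3 andbT eq_le -oppr_ge0 D1 D2.
Qed.

End Derivatives.

(** * Exponential generating series *)

Section EntireSeries.
Local Open Scope classical_set_scope.
Variable R : realType.
Implicit Types (a : nat -> R) (t : R).

Definition egf a k : R := a k / k`!%:R.

(** Geometric growth of [a] makes its exponential generating series entire; the
    powers of a matrix grow in this way. *)
Definition exp_bounded a := exists N M : R, forall k, `|a k| <= N * M ^+ k.

Lemma exp_bounded_shift a : exp_bounded a -> exp_bounded (fun k => a k.+1).
Proof.
move=> [N [M h]]; exists (N * M), M => k.
by rewrite (le_trans (h k.+1))// exprS mulrA.
Qed.

Lemma is_cvg_egf a t : exp_bounded a -> cvgn (pseries (egf a) t).
Proof.
move=> [N [M h]]; apply: normed_cvg.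
have hge k : 0 <= N * M ^+ k by rewrite (le_trans _ (h k)).
apply: (@series_le_cvg _ _ (fun k => N * ((M * `|t|) ^+ k / k`!%:R))).
- by move=> k; rewrite normr_ge0.
- move=> k; rewrite exprMn mulrA mulrA mulr_ge0 ?invr_ge0//.
  by rewrite mulr_ge0 ?exprn_ge0.
- move=> k /=; rewrite /egf exprMn !normrM normrX normfV [`|k`!%:R|]ger0_norm//.
  rewrite [leLHS]mulrAC !mulrA.
  by rewrite ler_wpM2r ?invr_ge0// ler_wpM2r ?exprn_ge0.
- rewrite (_ : (fun k => _) = N *: exp_coeff (M * `|t|)); last exact/funext.
  by apply: is_cvg_seriesZ; exact: is_cvg_series_exp_coeff.
Qed.

(** Differentiating the series shifts the sequence, which is why e^(tA) solves
    the differential equation of [A]. *)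
Lemma pseries_diffs_egf a : pseries_diffs (egf a) = egf (fun k => a k.+1).
Proof.
apply/funext => k; rewrite /pseries_diffs /egf factS natrM invfM.
by rewrite mulrCA mulVKf.
Qed.

Lemma is_derive_egf a t : exp_bounded a ->
  is_derive t 1 (fun s => limn (pseries (egf a) s))
    (limn (pseries (egf (fun k => a k.+1)) t)).
Proof.
move=> ha; rewrite -pseries_diffs_egf.
have ha1 := exp_bounded_shift ha; have ha2 := exp_bounded_shift ha1.
apply: (@pseries_snd_diffs _ _ (`|t| + 1)); rewrite ?pseries_diffs_egf.
- exact: is_cvg_egf.
- exact: is_cvg_egf.
- exact: is_cvg_egf.
- by rewrite [ltRHS]ger0_norm ?ltrDl// addr_ge0.
Qed.

Lemma limn_egf0 a : limn (pseries (egf a) 0) = a 0%N.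
Proof.
apply/cvg_lim => //; apply: cvg_near_cst; exists 1%N => //= -[//|n] _.
rewrite /pseries /series /= big_nat_recl//= expr0 mulr1 /egf fact0 divr1.
by rewrite big1 ?addr0// => i _; rewrite exprS mul0r mulr0.
Qed.

End EntireSeries.

(** * Exponentials of matrices acting on functions on a finite set *)

Section Exponential.
Local Open Scope classical_set_scope.
Variables (R : realType) (H : group_kind) (I : finType).
Local Notation K := (scalarK R H).
Variable A : I -> I -> K.
Implicit Types (u v : I -> K) (x y : I) (t s : R).

Definition mxop u x : K := \sum_y A x y * u y.

(** The function e^(tA) u, assembled from the real series of its coordinates so
    that termwise differentiation of real power series applies;
    [cvg_exp_series] identifies it with the sum of the scalar series. *)
Definition kexp t u x : K :=
  kmk H (limn (pseries (egf (fun k => kre (iter k mxop u x))) t))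
        (limn (pseries (egf (fun k => kim (iter k mxop u x))) t)).

(** Unlike the norm of the scalar field, this one takes its values in [R]; it is
    subadditive and submultiplicative, which is all that the bound on the powers
    of a matrix requires. *)
Definition abs1 (z : K) : R := `|kre z| + `|kim z|.

Lemma abs1_ge0 z : 0 <= abs1 z. Proof. by rewrite addr_ge0. Qed.

Lemma abs1M z w : abs1 (z * w) <= abs1 z * abs1 w.
Proof.
rewrite /abs1 kreM kimM (le_trans (lerD (ler_normB _ _) (ler_normD _ _)))//.
by rewrite !normrM; lra.
Qed.

Lemma abs1_sum (J : finType) (F : J -> K) :
  abs1 (\sum_i F i) <= \sum_i abs1 (F i).
Proof.
apply: (big_ind2 (fun z r => abs1 z <= r)) => //.
  by rewrite /abs1 kre0 kim0 normr0 addr0.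
move=> z r w q zr wq; apply: le_trans (lerD zr wq).
by rewrite /abs1 kreD kimD addrACA lerD// ler_normD.
Qed.

Lemma abs1_iter_mxop u x k :
  abs1 (iter k mxop u x) <=
    (\sum_y abs1 (u y)) * (\sum_x \sum_y abs1 (A x y)) ^+ k.
Proof.
set N := \sum_y abs1 (u y); set M := \sum_x _.
have le_sum (F : I -> R) y : (forall z, 0 <= F z) -> F y <= \sum_z F z.
  by move=> F0; rewrite (bigD1 y)//= lerDl sumr_ge0.
elim: k x => [|k IH] x.
  by rewrite expr0 mulr1 le_sum// => z; exact: abs1_ge0.
rewrite iterS /mxop (le_trans (abs1_sum _))//.
have M0 : 0 <= M.
  by apply: sumr_ge0 => y _; apply: sumr_ge0 => z _; exact: abs1_ge0.
have N0 : 0 <= N by apply: sumr_ge0 => y _; exact: abs1_ge0.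
apply: (@le_trans _ _ (\sum_y abs1 (A x y) * (N * M ^+ k))).
  apply: ler_sum => y _; rewrite (le_trans (abs1M _ _))//.
  by rewrite ler_wpM2l ?abs1_ge0.
rewrite -mulr_suml exprS [leRHS]mulrCA ler_wpM2r ?mulr_ge0 ?exprn_ge0//.
by apply: le_sum => y; apply: sumr_ge0 => z _; exact: abs1_ge0.
Qed.

Lemma exp_bounded_re u x : exp_bounded (fun k => kre (iter k mxop u x)).
Proof.
exists (\sum_y abs1 (u y)), (\sum_x \sum_y abs1 (A x y)) => k.
by rewrite (le_trans _ (abs1_iter_mxop u x k))// lerDl.
Qed.

Lemma exp_bounded_im u x : exp_bounded (fun k => kim (iter k mxop u x)).
Proof.
exists (\sum_y abs1 (u y)), (\sum_x \sum_y abs1 (A x y)) => k.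
by rewrite (le_trans _ (abs1_iter_mxop u x k))// lerDr.
Qed.

Lemma kim_limn t u x : H = Orthogonal ->
  limn (pseries (egf (fun k => kim (iter k mxop u x))) t) = 0.
Proof.
move=> HO; apply/cvg_lim => //; apply: cvg_near_cst; apply: nearW => n.
rewrite /pseries /series /= big1// => i _.
by rewrite /egf kim_orth// mul0r mul0r.
Qed.

Lemma kre_kexp t u x :
  kre (kexp t u x) = limn (pseries (egf (fun k => kre (iter k mxop u x))) t).
Proof. exact: kre_kmk. Qed.

Lemma kim_kexp t u x :
  kim (kexp t u x) = limn (pseries (egf (fun k => kim (iter k mxop u x))) t).
Proof. by rewrite kim_kmk// => HO; rewrite kim_limn. Qed.

Definition exp_series t u x : nat -> K :=
  series (fun k => embed H t ^+ k / k`!%:R * iter k mxop u x).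

Lemma cvg_exp_series t u x : exp_series t u x @ \oo --> kexp t u x.
Proof.
apply: cvg_kmk; first exact: kim_limn.
  rewrite (_ : (fun n => _) = pseries (egf (fun k => kre (iter k mxop u x))) t).
    exact: is_cvg_egf (exp_bounded_re _ _).
  apply/funext => n; rewrite /exp_series /series /= kre_sum.
  apply: eq_bigr => k _; rewrite -embedX -embed_nat -embedV -embedM kre_embedM.
  by rewrite /egf mulrC mulrA mulrAC.
rewrite (_ : (fun n => _) = pseries (egf (fun k => kim (iter k mxop u x))) t).
  exact: is_cvg_egf (exp_bounded_im _ _).
apply/funext => n; rewrite /exp_series /series /= kim_sum.
apply: eq_bigr => k _; rewrite -embedX -embed_nat -embedV -embedM kim_embedM.
by rewrite /egf mulrC mulrA mulrAC.
Qed.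

Lemma kexp_unique t u x (z : K) :
  exp_series t u x @ \oo --> z -> kexp t u x = z.
Proof.
move=> h; exact: (@cvg_unique K^o (@norm_hausdorff K K^o) _ _ _ _
                    (@cvg_exp_series t u x) h).
Qed.

Lemma kexp0 u x : kexp 0 u x = u x.
Proof. by apply: k_inj; rewrite ?kre_kexp ?kim_kexp limn_egf0. Qed.

Lemma kderiv_kexp t u x : kderiv (fun s => kexp s u x) t (kexp t (mxop u) x).
Proof.
split.
  rewrite kre_kexp; under eq_fun do rewrite kre_kexp.
  under [X in limn (pseries (egf X) t)]eq_fun do rewrite -iterSr.
  exact: is_derive_egf (exp_bounded_re _ _).
rewrite kim_kexp; under eq_fun do rewrite kim_kexp.
under [X in limn (pseries (egf X) t)]eq_fun do rewrite -iterSr.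
exact: is_derive_egf (exp_bounded_im _ _).
Qed.

Lemma cvg_comb (J : finType) (F : J -> nat -> K) (z c : J -> K) :
  (forall j, F j @ \oo --> z j) ->
  (fun n => \sum_j c j * F j n) @ \oo --> \sum_j c j * z j.
Proof.
move=> Fz; apply: cvg_big => // [|j _]; last by apply: cvgMl_tmp.
exact: add_continuous.
Qed.

Lemma kexp_mxop t u x : kexp t (mxop u) x = mxop (kexp t u) x.
Proof.
apply: kexp_unique; rewrite /mxop.
rewrite (_ : exp_series t _ x = fun n => \sum_y A x y * exp_series t u y n).
  by apply: cvg_comb => y; exact: cvg_exp_series.
apply/funext => n; rewrite /exp_series /series /=.
under [RHS]eq_bigr do rewrite mulr_sumr.
rewrite exchange_big /=; apply: eq_bigr => k _.
rewrite -[iter k mxop (fun _ => _) x]/(iter k mxop (mxop u) x).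
rewrite -iterSr iterS mulr_sumr.
by apply: eq_bigr => y _; rewrite mulrCA.
Qed.

Definition kdelta y x : K := (x == y)%:R.

Lemma iter_mxop_delta k u x :
  iter k mxop u x = \sum_y u y * iter k mxop (kdelta y) x.
Proof.
elim: k x => [|k IH] x.
  rewrite (bigD1 x)//= /kdelta eqxx mulr1 big1 ?addr0// => y yx.
  by rewrite eq_sym (negPf yx) mulr0.
rewrite iterS {1}/mxop; under eq_bigr do rewrite IH mulr_sumr.
rewrite exchange_big /=; apply: eq_bigr => y _.
by rewrite mulr_sumr; apply: eq_bigr => z _; rewrite mulrCA.
Qed.

(** The heat kernel expansion: it turns [kexp t u x], where [u] may itself
    depend on [t], into a finite sum of products of scalar functions of [t]. *)
Lemma kexp_delta t u x : kexp t u x = \sum_y u y * kexp t (kdelta y) x.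
Proof.
apply: kexp_unique.
rewrite (_ : exp_series t u x =
             fun n => \sum_y u y * exp_series t (kdelta y) x n).
  by apply: cvg_comb => y; exact: cvg_exp_series.
apply/funext => n; rewrite /exp_series /series /=.
under [RHS]eq_bigr do rewrite mulr_sumr.
rewrite exchange_big /=; apply: eq_bigr => k _.
by rewrite iter_mxop_delta mulr_sumr; apply: eq_bigr => y _; rewrite mulrCA.
Qed.

Lemma kexpD t u v x : kexp t (fun y => u y + v y) x = kexp t u x + kexp t v x.
Proof.
rewrite kexp_delta (kexp_delta t u) (kexp_delta t v) -big_split /=.
by apply: eq_bigr => y _; rewrite mulrDl.
Qed.

Lemma kexpZ t (c : K) u x : kexp t (fun y => c * u y) x = c * kexp t u x.
Proof.
rewrite kexp_delta (kexp_delta t u) mulr_sumr.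
by apply: eq_bigr => y _; rewrite mulrA.
Qed.

(** The product rule, applied to the sum in [kexp_delta]; the term in which the
    exponential is differentiated takes this form because A commutes with
    e^(sA). *)
Lemma kderiv_kexp_comp (U : R -> I -> K) (U' : I -> K) s x :
  (forall y, kderiv (fun r => U r y) s (U' y)) ->
  kderiv (fun r => kexp r (U r) x) s (kexp s (mxop (U s)) x + kexp s U' x).
Proof.
move=> dU.
apply: (@kderiv_ext _ _ (fun r => \sum_y U r y * kexp r (kdelta y) x)).
  by move=> r; rewrite -kexp_delta.
apply: kderiv_eq; last first.
  by apply: kderiv_sum => y; apply: kderivM; [exact: dU|exact: kderiv_kexp].
rewrite big_split /= addrC -(kexp_delta s U'); apply: (congr1 (+%R^~ _)).
rewrite kexp_mxop {2}/mxop.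
under eq_bigr do rewrite kexp_mxop mulr_sumr.
rewrite exchange_big /=; apply: eq_bigr => z _.
rewrite [in RHS]kexp_delta mulr_sumr.
by apply: eq_bigr => y _; rewrite mulrCA.
Qed.

Lemma mxopN u x : mxop (fun y => - u y) x = - mxop u x.
Proof. by rewrite /mxop -sumrN; apply: eq_bigr => y _; rewrite mulrN. Qed.

Lemma kexpN t u x : kexp t (fun y => - u y) x = - kexp t u x.
Proof.
rewrite -[RHS]mulN1r -kexpZ; congr (kexp t _ x); apply/funext => y.
by rewrite mulN1r.
Qed.

(** The function s |-> e^(sA) V(t - s) has zero derivative; its values at 0 and
    [t] are the two sides. *)
Lemma kexp_ode_unique (V : R -> I -> K) t x :
  (forall s y, kderiv (fun r => V r y) s (mxop (V s) y)) ->
  V t x = kexp t (V 0) x.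
Proof.
move=> dV.
have := @kderiv_const R H (fun s => kexp s (V (t - s)) x) 0 t.
rewrite kexp0 subr0 subrr; apply=> s.
apply: kderiv_eq; last first.
  apply: (kderiv_kexp_comp (U := fun s => V (t - s))) => y.
  exact: (kderiv_subl (F := fun r => V r y)).
by rewrite kexpN subrr.
Qed.

Lemma kexp_semigroup s t u x : kexp (s + t) u x = kexp s (kexp t u) x.
Proof.
rewrite (kexp_ode_unique (V := fun r => kexp (r + t) u)) ?add0r// => r y.
rewrite -kexp_mxop.
have [d1 d2] := kderiv_kexp (r + t) u y.
have ds : is_derive r 1 (fun q : R => q + t) 1.
  apply: is_derive_eq (is_deriveD (is_derive_id r 1) (is_derive_cst t r 1)) _.
  by rewrite addr0.
split.
  rewrite -[X in is_derive _ _ _ X]mulr1.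
  exact: (@is_derive1_comp R (fun r => kre (kexp r u y)) (fun q => q + t)
           r _ _ d1 ds).
rewrite -[X in is_derive _ _ _ X]mulr1.
exact: (@is_derive1_comp R (fun r => kim (kexp r u y)) (fun q => q + t)
           r _ _ d2 ds).
Qed.

End Exponential.

(** * Positivity of the exponential *)

Lemma is_derive_expRM (R : realType) (a s : R) :
  is_derive s 1 (fun q : R => expR (a * q)) (a * expR (a * s)).
Proof.
have ds : is_derive s 1 (fun q : R => a * q) a.
  apply: is_derive_eq (is_deriveZ a (is_derive_id s 1)) _.
  by rewrite /GRing.scale /= mulr1.
rewrite mulrC.
exact: (@is_derive1_comp R expR (fun q => a * q) s _ _ (is_derive_expR _) ds).
Qed.

Section Positivity.
Local Open Scope classical_set_scope.
Variables (R : realType) (H : group_kind) (I : finType).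
Local Notation K := (scalarK R H).
Implicit Types (A B : I -> I -> K).

Lemma egf_sum_ge0 (a : nat -> R) t : exp_bounded a -> 0 <= t ->
  (forall k, 0 <= a k) -> 0 <= limn (pseries (egf a) t).
Proof.
move=> ha t0 a0; apply: limr_ge; first exact: is_cvg_egf.
apply: nearW => n; apply: sumr_ge0 => k _.
by rewrite mulr_ge0 ?exprn_ge0// divr_ge0.
Qed.

Lemma kexp_ge0_nonneg B t u x : (forall x y, 0 <= B x y) -> 0 <= t ->
  (forall y, 0 <= u y) -> 0 <= kexp B t u x.
Proof.
move=> B0 t0 u0.
have it k y : 0 <= iter k (mxop B) u y.
  elim: k y => [|k IH] y; first exact: u0.
  by rewrite iterS; apply: sumr_ge0 => z _; exact/mulr_ge0/IH.
have it' k y : 0 <= kre (iter k (mxop B) u y) /\ kim (iter k (mxop B) u y) = 0.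
  by move: (it k y); rewrite lekE kre0 kim0 => /andP[/eqP].
rewrite lekE kre0 kim0 kre_kexp kim_kexp; apply/andP; split.
  apply/eqP/cvg_lim => //; apply: cvg_near_cst; apply: nearW => n.
  by rewrite /pseries /series /= big1// => i _; rewrite /egf (it' _ _).2 !mul0r.
apply: egf_sum_ge0 => // [|k]; first exact: exp_bounded_re.
exact: (it' _ _).1.
Qed.

(** With [B := A + c] entrywise nonnegative, e^(tA) = e^(-ct) e^(tB), because
    the right-hand side applied to [u] solves the differential equation of
    [A]. *)
Lemma kexp_ge0 A (c : R) t u x :
  (forall x y, 0 <= A x y + embed H c * (x == y)%:R) -> 0 <= t ->
  (forall y, 0 <= u y) -> 0 <= kexp A t u x.
Proof.
move=> A0 t0 u0; pose B x y := A x y + embed H c * (x == y)%:R.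
have BE v y : mxop B v y = mxop A v y + embed H c * v y.
  rewrite /mxop /B; under eq_bigr do rewrite mulrDl; rewrite big_split /=.
  congr (_ + _); rewrite (bigD1 y)//= eqxx mulr1 big1 ?addr0// => z zy.
  by rewrite eq_sym (negPf zy) mulr0 mul0r.
pose V s y := embed H (expR (- c * s)) * kexp B s u y.
have <- : V t x = kexp A t u x.
  rewrite (kexp_ode_unique (A := A) (V := V)).
    congr (kexp A t _ x); apply/funext => y.
    by rewrite /V mulr0 expR0 embed1 mul1r kexp0.
  move=> s y; apply: kderiv_eq; last first.
    apply: kderivM; last exact: kderiv_kexp.
    exact: (kderiv_embed H (is_derive_expRM (- c) s)).
  rewrite kexp_mxop BE embedM embedN /V.
  have -> : mxop A (fun y0 => embed H (expR (- c * s)) * kexp B s u y0) y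
          = embed H (expR (- c * s)) * mxop A (kexp B s u) y.
    by rewrite /mxop mulr_sumr; apply: eq_bigr => z _; rewrite mulrCA.
  by ring.
by rewrite mulr_ge0 ?embed_ge0 ?expR_ge0// kexp_ge0_nonneg.
Qed.

End Positivity.

(** * The two Laplacians as matrices *)

Lemma cvg_col (K : numFieldType) d (F : nat -> 'cV[K]_d) (M : 'cV[K]_d) :
  (forall i, F n i 0 @[n --> \oo] --> M i 0)%classic ->
  (F @ \oo --> M)%classic.
Proof.
move=> FM P [Q MQ sQP].
have : (\forall n \near \oo, forall i, Q i 0 (F n i 0))%classic.
  by apply: filter_forall => i; apply: FM; exact: MQ.
by apply: filterS => n Qn; apply: sQP => i j; rewrite (ord1 j).
Qed.

Section Laplacians.
Local Open Scope classical_set_scope.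
Variables (R : realType) (G : wgraph R) (H : group_kind) (d : nat).
Variable sigma : signature G H d.
Local Notation K := (scalarK R H).
Implicit Types (u v : G -> K) (f g : G -> 'cV[K]_d) (x y : G) (t s : R).
Local Notation L := (conn_laplacian sigma).
Local Notation Delta := (@laplacian R G H).

Definition lapmx x y : K :=
  (embed H (vmeas x))^-1 *
  ((if adj x y then embed H (weight x y) else 0)
   - (\sum_(z | adj x z) embed H (weight x z)) * (x == y)%:R).

Lemma laplacianE u : laplacian u = mxop lapmx u.
Proof.
apply/funext => x; rewrite /laplacian /mxop /lapmx.
under [RHS]eq_bigr do rewrite -mulrA mulrBl.
rewrite -mulr_sumr sumrB; congr (_ * _).
under eq_bigr do rewrite mulrBr.
rewrite sumrB big_mkcond /=; congr (_ - _).
  by apply: eq_bigr => y _; case: ifP; rewrite ?mul0r.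
rewrite [RHS](bigD1 x)//= eqxx mulr1 [X in _ = _ + X]big1 ?addr0 ?mulr_suml//.
by move=> y yx; rewrite eq_sym (negPf yx) mulr0 mul0r.
Qed.

(** Vector-valued functions on the vertices are scalar-valued functions on pairs
    of a vertex and a coordinate index ([flat] below). *)
Definition connmx (p q : G * 'I_d) : K :=
  (embed H (vmeas p.1))^-1 *
  ((if adj p.1 q.1 then embed H (weight p.1 q.1) * sigma p.1 q.1 p.2 q.2 else 0)
   - (\sum_(z | adj p.1 z) embed H (weight p.1 z)) * (p == q)%:R).

Definition flat f (p : G * 'I_d) : K := f p.1 p.2 0.

Lemma flat_conn_laplacian f : flat (L f) = mxop connmx (flat f).
Proof.
apply/funext => -[x i]; rewrite /flat /conn_laplacian /mxop /connmx /= mxE.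
rewrite summxE; under [RHS]eq_bigr do rewrite -mulrA mulrBl.
rewrite -mulr_sumr sumrB; congr (_ * _).
under [LHS]eq_bigr do
  rewrite mxE [X in _ * X]mxE [X in _ * (_ + X)]mxE mxE mulrBr.
rewrite sumrB big_mkcond /=; congr (_ - _).
  rewrite -(pair_bigA _ (fun y j => (if adj x y then embed H (weight x y) *
     sigma x y i j else 0) * f y j 0)) /=.
  apply: eq_bigr => y _; case: ifP => _.
    by rewrite mulr_sumr; apply: eq_bigr => j _; rewrite mulrA.
  by rewrite big1// => j _; rewrite mul0r.
rewrite [RHS](bigD1 (x, i))//= eqxx mulr1.
rewrite [X in _ = _ + X]big1 ?addr0 ?mulr_suml//.
by move=> y yx; rewrite eq_sym (negPf yx) mulr0 mul0r.
Qed.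

Lemma flat_iter f k : flat (iter k L f) = iter k (mxop connmx) (flat f).
Proof. by elim: k => // k IH; rewrite !iterS flat_conn_laplacian IH. Qed.

Lemma heatE t u : heat t u = kexp lapmx t u.
Proof.
apply/funext => x; rewrite /heat /exp_op.
apply: (@cvg_lim K^o (@norm_hausdorff K K^o)).
rewrite (_ : @laplacian R G H = mxop lapmx); last exact/funext/laplacianE.
exact: (@cvg_exp_series _ _ _ lapmx t u x).
Qed.

Lemma conn_heatE t f : flat (conn_heat sigma t f) = kexp connmx t (flat f).
Proof.
apply/funext => -[x i]; rewrite /flat /=.
have -> : conn_heat sigma t f x = \col_i kexp connmx t (flat f) (x, i).
  apply: (@cvg_lim _ (@norm_hausdorff K _)); apply: cvg_col => j.
  rewrite mxE; have := @cvg_exp_series _ _ _ connmx t (flat f) (x, j).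
  rewrite /exp_series (_ : series _ = fun n => series
    (fun k => (embed H t ^+ k / k`!%:R) *: iter k L f x) n j 0)//.
  apply/funext => n; rewrite /series /= summxE; apply: eq_bigr => k _.
  by rewrite mxE -flat_iter.
by rewrite mxE.
Qed.

Lemma heat0 u : heat 0 u = u.
Proof. by apply/funext => x; rewrite heatE kexp0. Qed.

Lemma eq_heat t u v x : (forall y, u y = v y) -> heat t u x = heat t v x.
Proof. by move=> /funext ->. Qed.

Lemma heatD t u v x : heat t (fun y => u y + v y) x = heat t u x + heat t v x.
Proof. by rewrite !heatE kexpD. Qed.

Lemma heatZ t (c : K) u x : heat t (fun y => c * u y) x = c * heat t u x.
Proof. by rewrite !heatE kexpZ. Qed.

(** Off the diagonal the Laplacian has nonnegative entries; adding the sum of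
    all weighted degrees makes the diagonal nonnegative too. *)
Lemma heat_ge0 t u x : 0 <= t -> (forall y, 0 <= u y) -> 0 <= heat t u x.
Proof.
move=> t0 u0; rewrite heatE.
pose deg x : R := (vmeas x)^-1 * \sum_(z | adj x z) weight x z.
have deg0 z : 0 <= deg z.
  rewrite mulr_ge0 ?invr_ge0 ?(ltW (vmeas_gt0 _))//.
  by apply: sumr_ge0 => q /weight_gt0/ltW.
apply: (@kexp_ge0 _ _ _ _ (\sum_z deg z)) => // {}x y.
have -> : lapmx x y + embed H (\sum_z deg z) * (x == y)%:R =
   embed H ((vmeas x)^-1 * (if adj x y then weight x y else 0)
            + (\sum_z deg z - deg x) * (x == y)%:R).
  rewrite /lapmx /deg !(embedM, embedD, embedN, embedV, embed_nat).
  rewrite (_ : embed H (\sum_(z | adj x z) weight x z) =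
              \sum_(z | adj x z) embed H (weight x z)).
    by case: (adj x y); rewrite ?embed0; ring.
  exact: (big_morph _ (@embedD _ _) (@embed0 _ _)).
apply: embed_ge0; apply: addr_ge0.
  rewrite mulr_ge0 ?invr_ge0 ?(ltW (vmeas_gt0 _))//.
  by case: ifP => // /weight_gt0/ltW.
by rewrite mulr_ge0// (bigD1 x)//= [deg x + _]addrC addrK sumr_ge0.
Qed.

(** * Derivatives of the quadratic forms along the semigroups *)

Lemma kderiv_mxop (I : finType) (A : I -> I -> K) (U : R -> I -> K)
    (U' : I -> K) s (x : I) :
  (forall y : I, kderiv (fun r => U r y) s (U' y)) ->
  kderiv (fun r => mxop A (U r) x) s (mxop A U' x).
Proof. by move=> dU; apply: kderiv_sum => y; exact: kderivMl. Qed.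

Definition vderiv (U : R -> G -> 'cV[K]_d) s (U' : G -> 'cV[K]_d) :=
  forall x i, kderiv (fun r => U r x i 0) s (U' x i 0).

Lemma kderiv_laplacian (U : R -> G -> K) U' s x :
  (forall y, kderiv (fun r => U r y) s (U' y)) ->
  kderiv (fun r => laplacian (U r) x) s (laplacian U' x).
Proof.
move=> dU; rewrite laplacianE; under eq_fun do rewrite laplacianE.
exact: kderiv_mxop.
Qed.

Lemma vderiv_conn_laplacian U s U' : vderiv U s U' ->
  vderiv (fun r => L (U r)) s (L U').
Proof.
move=> dU x i; rewrite -[L U' x i 0]/(flat (L U') (x, i)) flat_conn_laplacian.
apply: (@kderiv_ext _ _ (fun r => mxop connmx (flat (U r)) (x, i))).
  by move=> r; rewrite -flat_conn_laplacian.
by apply: kderiv_mxop => -[y j]; exact: dU.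
Qed.

Lemma hprodE f g x : hprod f g x = \sum_i f x i 0 * sconj (g x i 0).
Proof. by rewrite /hprod mxE; apply: eq_bigr => i _; rewrite !mxE. Qed.

Lemma kderiv_hprod U W s U' W' x : vderiv U s U' -> vderiv W s W' ->
  kderiv (fun r => hprod (U r) (W r) x) s (hprod U' (W s) x + hprod (U s) W' x).
Proof.
move=> dU dW; rewrite !hprodE -big_split /=; under eq_fun do rewrite hprodE.
apply: kderiv_sum => i; apply: kderivM; first exact: dU.
by apply: kderiv_conj; exact: dW.
Qed.

Lemma laplacianD u v x : Delta (fun y => u y + v y) x = Delta u x + Delta v x.
Proof.
rewrite !laplacianE /mxop -big_split; apply: eq_bigr => y _.
by rewrite mulrDr.
Qed.

Lemma laplacianZ (c : K) u x : Delta (fun y => c * u y) x = c * Delta u x.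
Proof.
by rewrite !laplacianE /mxop mulr_sumr; apply: eq_bigr => y _; rewrite mulrCA.
Qed.

Lemma laplacianN u x : Delta (fun y => - u y) x = - Delta u x.
Proof. by rewrite !laplacianE mxopN. Qed.

Lemma kderiv_Gamma U W s U' W' x : vderiv U s U' -> vderiv W s W' ->
  kderiv (fun r => Gamma sigma (U r) (W r) x) s
    (Gamma sigma U' (W s) x + Gamma sigma (U s) W' x).
Proof.
move=> dU dW; have dLU := vderiv_conn_laplacian dU.
have dLW := vderiv_conn_laplacian dW.
apply: kderiv_eq; last first.
  apply/kderivMl/kderivB; last exact: kderiv_hprod.
  apply: kderivB; last exact: kderiv_hprod.
  by apply: kderiv_laplacian => y; exact: (kderiv_hprod y dU dW).
by rewrite /Gamma laplacianD; ring.
Qed.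

Lemma kderiv_heat t u x :
  kderiv (fun s => heat s u x) t (heat t (laplacian u) x).
Proof.
rewrite heatE laplacianE; under eq_fun do rewrite heatE.
exact: kderiv_kexp.
Qed.

Lemma kderiv_heat_comp (U : R -> G -> K) U' s x :
  (forall y, kderiv (fun r => U r y) s (U' y)) ->
  kderiv (fun r => heat r (U r) x) s
    (heat s (fun y => laplacian (U s) y + U' y) x).
Proof.
move=> dU; rewrite heatD !heatE laplacianE; under eq_fun do rewrite heatE.
exact: kderiv_kexp_comp.
Qed.

Lemma flat_inj f g : flat f = flat g -> f = g.
Proof.
move=> e; apply/funext => x; apply/colP => i.
exact: (congr1 (fun h => h (x, i)) e).
Qed.

Lemma conn_heat0 f : conn_heat sigma 0 f = f.
Proof.
by apply: flat_inj; rewrite conn_heatE; apply/funext => p; rewrite kexp0.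
Qed.

Lemma conn_heat_semigroup s t f :
  conn_heat sigma (s + t) f = conn_heat sigma s (conn_heat sigma t f).
Proof.
apply: flat_inj; rewrite !conn_heatE; apply/funext => p.
exact: kexp_semigroup.
Qed.

Lemma vderiv_conn_heat t f :
  vderiv (fun s => conn_heat sigma s f) t (L (conn_heat sigma t f)).
Proof.
move=> x i.
rewrite -[L _ x i 0]/(flat (L (conn_heat sigma t f)) (x, i)).
rewrite flat_conn_laplacian conn_heatE -kexp_mxop.
apply: (@kderiv_ext _ _ (fun s => kexp connmx s (flat f) (x, i))).
  by move=> s; rewrite -conn_heatE.
exact: kderiv_kexp.
Qed.

End Laplacians.

(** * The three implications *)

Section Implications.
Variables (R : realType) (G : wgraph R) (H : group_kind) (d : nat).
Variable sigma : signature G H d.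
Local Notation K := (scalarK R H).
Implicit Types (u v : G -> K) (f g : G -> 'cV[K]_d) (x y : G) (t s : R).
Local Notation L := (conn_laplacian sigma).
Local Notation P := (conn_heat sigma).
Local Notation Gam := (Gamma sigma).
Variable kappa : R.

Lemma Gamma2_double f x :
  2 * Gamma2 sigma f f x =
  laplacian (Gam f f) x - Gam f (L f) x - Gam (L f) f x.
Proof. by rewrite /Gamma2 mulrA divff ?mul1r// pnatr_eq0. Qed.

Lemma Gamma_double f x :
  2 * Gam f f x = laplacian (sqnorm f) x - hprod f (L f) x - hprod (L f) f x.
Proof. by rewrite /Gamma mulrA divff ?mul1r// pnatr_eq0. Qed.

(** By the curvature-dimension condition, the derivative of
    s |-> e^(-2 kappa s) P_s (Gamma^sigma (P^sigma_(t-s) f)) is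
    e^(-2 kappa s) P_s applied to a nonnegative function. *)
Lemma gradient_estimate : CD_infty sigma kappa ->
  forall f t, 0 <= t -> forall x,
    Gam (P t f) (P t f) x
      <= embed H (expR (- 2 * kappa * t)) * heat t (Gam f f) x.
Proof.
move=> CD f t t0 x.
pose V r := P r f.
pose F s := embed H (expR (- 2 * kappa * s)) *
  heat s (Gam (V (t - s)) (V (t - s))) x.
(* This form of the derivative comes from the product rule and
   [Gamma2_double]. *)
pose D s := embed H (expR (- 2 * kappa * s)) *
  heat s (fun y => 2 * (Gamma2 sigma (V (t - s)) (V (t - s)) y
                        - embed H kappa * Gam (V (t - s)) (V (t - s)) y)) x.
have dF s : kderiv F s (D s).
  apply: kderiv_eq; last first.
    apply: kderivM.
      exact: (kderiv_embed H (is_derive_expRM (- 2 * kappa) s)).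
    apply: (kderiv_heat_comp (U := fun s => Gam (V (t - s)) (V (t - s)))) => y.
    apply: (kderiv_subl (F := fun r => Gam (V r) (V r) y)).
    by apply: kderiv_Gamma; exact: vderiv_conn_heat.
  rewrite /D embedM [embed H _ * embed H _]mulrC.
  rewrite -[embed H _ * embed H _ * _]mulrA -mulrDr -heatZ -heatD.
  apply: (congr1 ( *%R _)); apply: eq_heat => y.
  rewrite mulrBr Gamma2_double !embedM embedN embed_nat.
  by rewrite /V; ring.
have := kderiv_le t0 dF; rewrite /F mulr0 expR0 embed1 mul1r heat0 subr0 subrr.
rewrite /V conn_heat0; apply=> s s0 st.
rewrite /D mulr_ge0 ?embed_ge0 ?expR_ge0// heat_ge0// => y.
by rewrite mulr_ge0// subr_ge0.
Qed.

Lemma exp_coef0 : exp_coef kappa 0 = 0.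
Proof. by rewrite /exp_coef !mulr0 expR0 subrr mul0r; case: ifP. Qed.

Lemma is_derive_exp_coef s :
  is_derive s 1 (exp_coef kappa) (2 * expR (2 * kappa * s)).
Proof.
rewrite /exp_coef; have [->|k0] := eqVneq kappa 0.
  rewrite mulr0 mul0r expR0 mulr1.
  apply: is_derive_eq (is_deriveZ 2 (is_derive_id s 1)) _.
  by rewrite /GRing.scale /= mulr1.
under eq_fun do rewrite mulrC.
have h : is_derive s 1 (fun q : R => kappa^-1 * (expR (2 * kappa * q) - 1))
    (kappa^-1 *: (2 * kappa * expR (2 * kappa * s) - 0)).
  have h1 := is_derive_expRM (2 * kappa) s.
  have h0 : is_derive s 1 (fun=> 1 : R) 0 := is_derive_cst _ _ _.
  exact: (is_deriveZ _ (is_deriveB h1 h0)).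
apply: is_derive_eq h _.
by rewrite /GRing.scale /= subr0; field.
Qed.

(** The derivative of
    s |-> P_s (|P^sigma_(t-s) f|^2)
          - exp_coef kappa s * Gamma^sigma (P^sigma_t f)
    is nonnegative: this is the gradient estimate at time [s] for
    P^sigma_(t-s) f, multiplied by 2 e^(2 kappa s). *)
Lemma variance_estimate :
  (forall f t, 0 <= t -> forall x,
    Gam (P t f) (P t f) x
      <= embed H (expR (- 2 * kappa * t)) * heat t (Gam f f) x) ->
  forall f t, 0 <= t -> forall x,
    embed H (exp_coef kappa t) * Gam (P t f) (P t f) x
      <= heat t (sqnorm f) x - sqnorm (P t f) x.
Proof.
move=> grad f t t0 x.
pose V r := P r f.
pose F s := heat s (sqnorm (V (t - s))) x -
  embed H (exp_coef kappa s) * Gam (V t) (V t) x.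
pose D s := heat s (fun y => 2 * Gam (V (t - s)) (V (t - s)) y) x -
  embed H (2 * expR (2 * kappa * s)) * Gam (V t) (V t) x.
have dF s : kderiv F s (D s).
  apply: kderiv_eq; last first.
    apply: kderivB.
      apply: (kderiv_heat_comp (U := fun s => sqnorm (V (t - s)))) => y.
      apply: (kderiv_subl (F := fun r => sqnorm (V r) y)).
      by apply: kderiv_hprod; exact: vderiv_conn_heat.
    apply: kderivM (kderiv_cst _ _).
    exact: (kderiv_embed H (is_derive_exp_coef s)).
  rewrite /D mulr0 addr0; apply: (congr1 (+%R^~ _)); apply: eq_heat => y.
  by rewrite Gamma_double /V; ring.
have := kderiv_le t0 dF.
rewrite /F exp_coef0 embed0 mul0r heat0 !subr0 subrr /V conn_heat0.
rewrite lerBrDr -lerBrDl; apply=> s s0 st.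
rewrite /D heatZ subr_ge0 embedM embed_nat -mulrA ler_pM2l//.
have := grad (V (t - s)) s s0 x; rewrite /V -conn_heat_semigroup addrC subrK.
move=> /(ler_wpM2l (embed_ge0 H (expR_ge0 (2 * kappa * s)))).
rewrite [X in _ <= X -> _]mulrA -embedM -expRD !mulNr addrN.
by rewrite expR0 embed1 mul1r.
Qed.

(** The variance estimate is an equality to first order at [t = 0], so its
    second order term has a sign, and twice that term is
    4 (Gamma_2^sigma f - kappa Gamma^sigma f). *)
Lemma curvature_dimension :
  (forall f t, 0 <= t -> forall x,
    embed H (exp_coef kappa t) * Gam (P t f) (P t f) x
      <= heat t (sqnorm f) x - sqnorm (P t f) x) ->
  CD_infty sigma kappa.
Proof.
move=> var f x.
pose V r := P r f.
have dV s : vderiv V s (L (V s)) by exact: vderiv_conn_heat.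
have dLV s : vderiv (fun r => L (V r)) s (L (L (V s))).
  exact: vderiv_conn_laplacian.
have V0 : V 0 = f by exact: conn_heat0.
pose c := exp_coef kappa.
pose c' s := 2 * expR (2 * kappa * s).
pose F s := heat s (sqnorm f) x - sqnorm (V s) x
  - embed H (c s) * Gam (V s) (V s) x.
pose F' s := heat s (laplacian (sqnorm f)) x
  - (hprod (L (V s)) (V s) x + hprod (V s) (L (V s)) x)
  - (embed H (c' s) * Gam (V s) (V s) x + embed H (c s) *
       (Gam (L (V s)) (V s) x + Gam (V s) (L (V s)) x)).
have dF s : kderiv F s (F' s).
  apply: kderivB; first apply: kderivB.
  - exact: kderiv_heat.
  - by apply: kderiv_hprod.
  - apply: kderivM; last exact: kderiv_Gamma.
    exact: (kderiv_embed H (is_derive_exp_coef s)).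
have dc' : is_derive (0 : R) 1 c' (2 *: (2 * kappa * expR (2 * kappa * 0))).
  have h := is_derive_expRM (2 * kappa) 0.
  exact: (is_deriveZ _ h).
pose D := 4 * (Gamma2 sigma f f x - embed H kappa * Gam f f x).
have dF' : kderiv F' 0 D.
  apply: kderiv_eq; last first.
    apply: kderivB; first apply: kderivB.
    - exact: kderiv_heat.
    - by apply: kderivD; apply: kderiv_hprod.
    - apply: kderivD; apply: kderivM.
      + exact: (kderiv_embed H dc').
      + exact: kderiv_Gamma.
      + exact: (kderiv_embed H (is_derive_exp_coef 0)).
      + by apply: kderivD; apply: kderiv_Gamma.
  have h4 : 4 = 2 * 2 :> K by rewrite -natrM.
  rewrite heat0 V0 /c /c' exp_coef0 mulr0 expR0 mulr1 /GRing.scale /= embed0.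
  rewrite mul0r addr0 /D mulrBr h4.
  rewrite -[2 * 2 * Gamma2 _ _ _ _]mulrA Gamma2_double !embedM embed_nat embed1.
  have -> : 2 * (laplacian (Gam f f) x - Gam f (L f) x - Gam (L f) f x) =
     laplacian (fun y => 2 * Gam f f y) x - 2 * (Gam f (L f) x + Gam (L f) f x).
    by rewrite laplacianZ; ring.
  have -> : (fun y => 2 * Gam f f y) =
     (fun y => laplacian (sqnorm f) y + - (hprod f (L f) y + hprod (L f) f y)).
    by apply/funext => y; rewrite Gamma_double; ring.
  rewrite laplacianD laplacianN laplacianD.
  (* All terms are now expressed through Gamma^sigma and [hprod]; those in
     L f and L (L f) cancel. *)
  have h2 : 2 * 2^-1 = 1 :> K by rewrite divff// pnatr_eq0.
  have e1 : laplacian (hprod f (L f)) x = 2 * Gam f (L f) x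
      + hprod f (L (L f)) x
      + hprod (L f) (L f) x by rewrite /Gamma mulrA h2; ring.
  have e2 : laplacian (hprod (L f) f) x = 2 * Gam (L f) f x
      + hprod (L f) (L f) x
      + hprod (L (L f)) f x by rewrite /Gamma mulrA h2; ring.
  by rewrite e1 e2; ring.
have F0 : F 0 = 0.
  by rewrite /F V0 heat0 /c exp_coef0 embed0 mul0r subr0 subrr.
have F'0 : F' 0 = 0.
  rewrite /F' V0 heat0 /c /c' exp_coef0 mulr0 expR0 mulr1 embed0 embed_nat.
  by rewrite mul0r addr0 Gamma_double; ring.
have := kderiv2_ge0 dF dF' F0 F'0.
rewrite /D pmulr_rge0 ?subr_ge0//; apply=> s s0.
by rewrite /F subr_ge0; exact: var.
Qed.

End Implications.

Theorem theorem3p20 (R : realType) (G : wgraph R) (H : group_kind) (d : nat)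
    (sigma : signature G H d) (kappa : R) :
  [<-> CD_infty sigma kappa;
       forall (f : G -> 'cV[scalarK R H]_d) (t : R), 0 <= t -> forall x : G,
         Gamma sigma (conn_heat sigma t f) (conn_heat sigma t f) x
           <= embed H (expR (- 2 * kappa * t))
              * heat t (Gamma sigma f f) x;
       forall (f : G -> 'cV[scalarK R H]_d) (t : R), 0 <= t -> forall x : G,
         embed H (exp_coef kappa t)
           * Gamma sigma (conn_heat sigma t f) (conn_heat sigma t f) x
           <= heat t (sqnorm f) x - sqnorm (conn_heat sigma t f) x].
Proof.
tfae.
- exact: gradient_estimate.
- exact: variance_estimate.
- exact: curvature_dimension.
Qed.
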